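(* Let $\tilde\omega=((x,\tau),F,T,N)\in\tilde\Omega$ be a realization of the graphical construction that stabilizes. Suppose $\tilde\omega'=((x',\tau'),F',T',N')\in\tilde\Omega$ satisfies $\tilde\omega'\preceq\tilde\omega$. Then $\tilde\omega'$ also stabilizes, and $R_z(\tilde\omega')\le R_z(\tilde\omega)$ for every site $z\in S$.
   Context: Graphical construction of activated random walks with finitely many particles on $S=\mathbb{Z}$ with nearest-neighbor jumps. This is a deterministic construction. $\tilde\Omega$ is the set of all $\tilde\omega=((x,\tau),F,T,N)$ such that, for some $m\ge 0$: $x=(x_1,\dots,x_m)\in S^m$ (initial particle positions), $\tau\in\{A,B\}^m$ (initial particle types, $A$ = passive, $B$ = active), $F=(F_{z,j})_{z\in S,j\in\mathbb{N}}\in\{-1,0,1\}^{S\times\mathbb{N}}$, $\mathbb{N}=\{1,2,\dots\}$ ($F_{z,j}$ is the $j$-th ''envelope'' at site $z$: $\pm1$ is a jump envelope, $0$ a sleep envelope), $T=(0=t_0<t_1<t_2<\cdots)$ with $t_i\uparrow\infty$, and $N=(n_1,n_2,\dots)\in\{1,\dots,m\}^{\mathbb{N}}$ is a sequence in which each symbol of $\{1,\dots,m\}$ appears infinitely many times. A state is $X=((x_n,\tau_n)_{n=1}^m,(j_z)_{z\in S})\in S^m\times\{A,B\}^m\times\mathbb{Z}_+^S$, where $x_n$ and $\tau_n$ are the position and type of particle $n$ and $j_z$ is the number of envelopes already burned at site $z$. For $\tilde n\in\{1,\dots,m\}$ define the state $\tilde n\cdot X$ as follows. If $\tau_{\tilde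 n}=A$, then $\tilde n\cdot X=X$. If $\tau_{\tilde n}=B$, put $\tilde x=x_{\tilde n}$, increase $j_{\tilde x}$ by one, and execute the envelope $F_{\tilde x,\tilde j}$, where $\tilde j$ is the new value of $j_{\tilde x}$: if $F_{\tilde x,\tilde j}=0$, the type of particle $\tilde n$ becomes $A$ if no other particle is located at $\tilde x$ and nothing else changes otherwise; if $F_{\tilde x,\tilde j}=\pm1$, particle $\tilde n$ moves to $\tilde x\pm1$ (remaining of type $B$) and all particles located at $\tilde x\pm1$ become of type $B$. Given $\tilde\omega$, let $X_0=((x,\tau),j\equiv0)$ and $X_i=n_i\cdot X_{i-1}$ for $i\ge1$. For a state $X$, $\eta[X]=(\eta^A(z),\eta^B(z))_{z\in S}$ where $\eta^A(z)$ (resp. $\eta^B(z)$) is the number of particles of type $A$ (resp. $B$) at $z$. The process is $\eta_t(\tilde\omega)=\eta[X_i]$ for $t\in[t_i,t_{i+1})$. $\tilde\omega$ stabilizes if there are $t_0$ and a configuration $\eta$ such that $\eta_t(\tilde\omega)=\eta$ for all $t\ge t_0$ and all particles are passive in $\eta$. $R_z(\tilde\omega)$ denotes the total number of jump envelopes burned (executed) at site $z$ during the whole evolution. The relation $\tilde\omega'\preceq\tilde\omega$ means: all particles present in the initial state of $\tilde\omega'$ are present in that of $\tilde\omega$ at the same positions (i.e. there is an injection from the particles of $\tilde\omega'$ to those of $\tilde\omega$ preserving positions); under this identification all particles that are active in $\tilde\omega'$ are also active in $\tilde\omega$; and $F'$ is obtained from $F$ by inserting sleep envelopes in the sequences $(F_{z,j})_{j\in\mathbb{N}}$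 for some sites $z$ (i.e. for each $z$ there is a strictly increasing $\varphi_z:\mathbb{N}\to\mathbb{N}$ with $F'_{z,\varphi_z(j)}=F_{z,j}$ for all $j$ and $F'_{z,i}=0$ for every $i$ not in the image of $\varphi_z$). No relation between $(T,N)$ and $(T',N')$ is required. *)

(* Defs.v *)
From HB Require Import structures.
From mathcomp Require Import all_boot all_order all_algebra.
From mathcomp Require Import all_classical all_reals all_analysis.

Set Implicit Arguments.
Unset Strict Implicit.
Unset Printing Implicit Defensive.

Import Order.TTheory GRing.Theory Num.Theory.
Import numFieldNormedType.Exports.

Local Open Scope classical_set_scope.
Local Open Scope ring_scope.

(* Types are Booleans: true is B (active), false is A (passive).              *)
(* The sequences indexed by {1, 2, ...} are shifted to start at 0:            *)
(* [envelope z j] is F_{z,j+1} and [label i] is n_{i+1}.                      *)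
(* [label] takes values in [option] only to allow m = 0, where there is no    *)
(* symbol to list: it is then constantly [None].  For m > 0 it never is.      *)
Record realization (R : realType) := Realization {
  npart : nat;
  pos0 : 'I_npart -> int;
  active0 : 'I_npart -> bool;
  envelope : int -> nat -> int;
  time : nat -> R;
  label : nat -> option 'I_npart;
  envelope_range : forall z j, envelope z j \in [:: -1; 0; 1];
  time0 : time 0 = 0;
  time_increasing : {homo time : i k / (i < k)%N >-> i < k};
  time_unbounded : time @ \oo --> +oo;
  label_some : forall i, (0 < npart)%N -> label i != None;
  label_infinitely_often :
    forall (n : 'I_npart) k, exists2 i, (k <= i)%N & label i = Some n
}.

Record state (m : nat) := State {
  pos : 'I_m -> int;
  active : 'I_m -> bool;
  burned : int -> nat
}.

Section Dynamics.
Variables (m : nat) (F : int -> nat -> int).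
Implicit Types (X : state m) (n : 'I_m).

(* Because of the shift, the envelope with (new) number (burned X z).+1 is    *)
(* [F z (burned X z)].                                                        *)
Definition next_envelope X (z : int) : int := F z (burned X z).

Definition alone X n : bool := [forall k, (k != n) ==> (pos X k != pos X n)].

Definition act_particle n X : state m :=
  if ~~ active X n then X else
  let z := pos X n in
  let e := next_envelope X z in
  let burned' := fun y => if y == z then (burned X y).+1 else burned X y in
  if e == 0 then
    State (pos X)
          (fun k => if (k == n) && alone X n then false else active X k)
          burned'
  else
    State (fun k => if k == n then z + e else pos X k)
          (fun k => active X k || (pos X k == z + e))
          burned'.

End Dynamics.

Definition config := int -> nat * nat.

Definition configuration m (X : state m) : config := fun z =>
  (#|[pred n | (pos X n == z) && ~~ active X n]|,
   #|[pred n | (pos X n == z) && active X n]|).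

Section Evolution.
Variables (R : realType) (w : realization R).

Fixpoint state_at (i : nat) : state (npart w) :=
  if i is i'.+1 then
    if label w i' is Some n then act_particle (envelope w) n (state_at i')
    else state_at i'
  else State (@pos0 _ w) (@active0 _ w) (fun=> 0%N).

Definition process (t : R) : config :=
  configuration (state_at (xget 0%N [set i | time w i <= t < time w i.+1])).

Definition all_passive (eta : config) : Prop := forall z, (eta z).2 = 0%N.

Definition stabilizes : Prop :=
  exists t0 : R, 0 <= t0 /\
  exists eta : config,
    (forall t, t0 <= t -> process t = eta) /\ all_passive eta.

Definition burns_jump (z : int) (i : nat) : bool :=
  if label w i is Some n then
    let X := state_at i in
    [&& active X n, pos X n == z & next_envelope (envelope w) X z != 0]
  else false.

(* Extended-real valued: a priori infinitely many jumps may occur at z.       *)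
Definition jumps_at (z : int) : \bar R :=
  (\sum_(0 <= i <oo) (burns_jump z i)%:R%:E)%E.

End Evolution.

Definition sleep_insertion (F' F : int -> nat -> int) : Prop :=
  forall z, exists phi : nat -> nat,
    [/\ {homo phi : i j / (i < j)%N},
        forall j, F' z (phi j) = F z j
      & forall i, (forall j, phi j <> i) -> F' z i = 0].

Definition preceq (R : realType) (w' w : realization R) : Prop :=
  (exists f : 'I_(npart w') -> 'I_(npart w),
     [/\ injective f,
         forall n, pos0 (f n) = pos0 n
       & forall n, active0 n -> active0 (f n)])
  /\ sleep_insertion (envelope w') (envelope w).

(* Main.v *)
Require Import Defs.
From mathcomp Require Import all_boot all_order all_algebra.
From mathcomp Require Import all_classical all_reals all_analysis.
From mathcomp Require Import zify.

Set Implicit Arguments.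
Unset Strict Implicit.
Unset Printing Implicit Defensive.

Import Order.TTheory GRing.Theory Num.Theory.

Local Open Scope ring_scope.

(** The proof compares the numbers of burned envelopes.  Since [w] stabilizes,
all its particles are passive at some step [i]; let J z be the number of
envelopes that [w] has burned at [z] by then.  The first J z envelopes of [w]
at [z] form, with the inserted sleep envelopes, an initial segment of the
sequence of [w'] at [z], ending exactly at the copy of envelope number J z; its
length is called the quota of [z].  The claim ([burned_le_quota]) is that [w']
never burns more than its quota at any site.

Both conclusions follow.  The quotas vanish outside finitely many sites, so
[w'] burns finitely many envelopes in total, and every particle is selected
infinitely often, so eventually all are passive ([eventually_frozen]).
Moreover the initial segment contains as many jump envelopes as were burned by
[w] ([departures_le]).

To prove the claim, suppose that no quota is exceeded, that the quota of [z] is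
exhausted, and that [w'] still has an active particle at [z]
([awake_below_quota]).  As many jumps left [z] in [w'] as in [w], at most as many
reached it, and [w'] started with at most as many particles there; hence [w']
has at most as many particles at [z] as [w] has.  Since the particles of [w] at
[z] are all passive, [passive_site_history] leaves three possibilities.
- There are none; then [w'] has none either.
- No particle ever reached [z] and every particle initially active at [z] has
  been matched by a jump out of [z]; then the same holds in [w'], which has no
  active particle left at [z] ([awake_without_arrivals]).
- There is a single particle, and the last envelope burned at [z] is a sleep
  envelope.  Then the last envelope burned at [z] by [w'] is its copy, hence
  also a sleep envelope, and after a sleep envelope a lone particle is passive
  as long as no further envelope is burned there ([after_last_sleep]).
The second case is not void even for several particles: passive particles may
share a site initially. *)

(** * Site observables and their evolution in one step *)

Section Observables.
Variables (m : nat) (F : int -> nat -> int).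
Implicit Types (X : state m) (n : 'I_m) (y z : int) (p : pred int).

(** The number of particles at [z]. *)
Definition occupancy X z : nat := (\sum_(n < m) (pos X n == z))%N.

(** The number of active particles at [z]. *)
Definition awake X z : nat := (\sum_(n < m) (active X n && (pos X n == z)))%N.

(** The number of values satisfying [p] among the first [k] of [f]. *)
Definition tally (f : nat -> int) p (k : nat) : nat :=
  (\sum_(i < k) p (f i))%N.

(** The number of jump envelopes burned at [z], that is, of jumps out of [z]. *)
Definition departures X z : nat := tally (F z) (predC1 0) (burned X z).

(** The number of jumps into [z]: rightward ones burned at [z - 1] and leftward
ones burned at [z + 1]. *)
Definition arrivals X z : nat :=
  (tally (F (z - 1)%R) (pred1 1%R) (burned X (z - 1)%R) +
   tally (F (z + 1)%R) (pred1 (- 1)%R) (burned X (z + 1)%R))%N.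

(** Some envelope has been burned at [z], and the last one is a sleep envelope. *)
Definition last_sleep X z : bool :=
  (0 < burned X z)%N && (F z (burned X z).-1 == 0).

Lemma tally0 f p : tally f p 0 = 0%N.
Proof. exact: big_ord0. Qed.

Lemma tallyS f p k : tally f p k.+1 = (tally f p k + p (f k))%N.
Proof. by rewrite /tally big_ord_recr. Qed.

Lemma leq_tally f p k l : (k <= l)%N -> (tally f p k <= tally f p l)%N.
Proof.
move=> /subnKC <-; elim: (l - k)%N => [|d IH]; first by rewrite addn0.
by rewrite addnS tallyS (leq_trans IH) ?leq_addr.
Qed.

Lemma awake_le_occupancy X z : (awake X z <= occupancy X z)%N.
Proof. by apply: leq_sum => n _; case: (active X n). Qed.

Lemma awake_gt0 X n : active X n -> (0 < awake X (pos X n))%N.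
Proof. by move=> an; rewrite /awake (bigD1 n) //= an eqxx. Qed.

Lemma alone_occupancy X n : alone X n -> occupancy X (pos X n) = 1%N.
Proof.
move=> /forallP al; rewrite /occupancy (bigD1 n) //= eqxx big1 ?addn0 // => k kn.
by move: (al k); rewrite kn /= => /negbTE ->.
Qed.

Lemma not_alone_occupancy X n : ~~ alone X n -> (1 < occupancy X (pos X n))%N.
Proof.
rewrite negb_forall => /existsP[k]; rewrite negb_imply negbK => /andP[kn /eqP pk].
by rewrite /occupancy (bigD1 n) //= (bigD1 k) //= pk !eqxx.
Qed.

(** One step of an active particle [n] at [x], which burns the envelope [e]. *)
Section Step.
Variables (X : state m) (n : 'I_m).
Hypothesis n_active : active X n.
Hypothesis F_range : forall z j, F z j \in [:: -1; 0; 1].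

Let x := pos X n.
Let e := F x (burned X x).
Let X' := act_particle F n X.

Lemma burned_act y : burned X' y = (burned X y + (y == x))%N.
Proof.
rewrite /X' /act_particle n_active /= -/x; case: ifP => _ /=;
  by case: eqP => _; rewrite ?addn1 ?addn0.
Qed.

Lemma tally_act y p :
  tally (F y) p (burned X' y) =
  (tally (F y) p (burned X y) + ((y == x) && p e))%N.
Proof.
rewrite burned_act; case: eqVneq => [->|_] /=; last by rewrite !addn0.
by rewrite addn1 tallyS.
Qed.

Lemma departures_act y :
  departures X' y = (departures X y + ((y == x) && (e != 0)))%N.
Proof. exact: tally_act. Qed.

Lemma arrivals_act y :
  arrivals X' y = (arrivals X y + ((e != 0) && (y == (x + e)%R)))%N.
Proof.
rewrite /arrivals !tally_act /=.
have : e \in [:: -1; 0; 1] by exact: F_range.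
rewrite !inE => /or3P[] /eqP -> /=; lia.
Qed.

Lemma last_sleep_act y :
  last_sleep X' y = if y == x then e == 0 else last_sleep X y.
Proof.
rewrite /last_sleep burned_act; case: eqVneq => [->|_]; last by rewrite addn0.
by rewrite addn1.
Qed.

Lemma occupancy_sleep y : e = 0 -> occupancy X' y = occupancy X y.
Proof.
by move=> e0; rewrite /X' /act_particle n_active /= /next_envelope -/x -/e e0 eqxx.
Qed.

Lemma awake_sleep y : e = 0 ->
  awake X' y = if alone X n && (y == x) then 0%N else awake X y.
Proof.
move=> e0; rewrite /X' /act_particle n_active /= /next_envelope -/x -/e e0 eqxx.
rewrite /awake /=; case: (boolP (alone X n)) => al /=; last first.
  by apply: eq_bigr => k _; rewrite andbF.
case: eqVneq => [->|yx].
  apply: big1 => k _; rewrite andbT; case: (eqVneq k n) => [//|kn].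
  by move/forallP/(_ k): al; rewrite kn /= => /negbTE ->; rewrite andbF.
apply: eq_bigr => k _; rewrite andbT; case: (eqVneq k n) => [->|//].
by rewrite n_active /= -/x [x == y]eq_sym (negbTE yx).
Qed.

Lemma occupancy_jump y : e != 0 ->
  (occupancy X' y + (y == x) = occupancy X y + (y == (x + e)%R))%N.
Proof.
move=> /negbTE e0; rewrite /X' /act_particle n_active /= /next_envelope -/x -/e e0.
rewrite /occupancy (bigD1 n) //= [in RHS](bigD1 n) //= eqxx -/x.
rewrite (eq_bigr (fun k => nat_of_bool (pos X k == y))); last first.
  by move=> k /negbTE ->.
by rewrite [y == x]eq_sym [y == (x + e)%R]eq_sym addnC addnCA [RHS]addnC.
Qed.

Lemma awake_jump_target : e != 0 -> awake X' (x + e) = occupancy X' (x + e).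
Proof.
move=> /negbTE e0; rewrite /X' /act_particle n_active /= /next_envelope -/x -/e e0.
apply: eq_bigr => k _ /=; case: (eqVneq k n) => [->|_].
  by rewrite n_active.
by case: eqP; rewrite ?orbT ?andbF.
Qed.

Lemma awake_jump y : e != 0 -> y != x + e ->
  (awake X' y + (y == x) = awake X y)%N.
Proof.
move=> /negbTE e0 ye.
rewrite /X' /act_particle n_active /= /next_envelope -/x -/e e0.
rewrite /awake (bigD1 n) //= [in RHS](bigD1 n) //= eqxx -/x n_active /=.
rewrite [x + e == y]eq_sym (negbTE ye) [y == x]eq_sym add0n addnC; congr addn.
apply: eq_bigr => k /negbTE ->.
case: (eqVneq (pos X k) y) => [->|]; last by rewrite !andbF.
by rewrite (negbTE ye) orbF.
Qed.

End Step.
End Observables.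

(** * Invariants of the evolution *)

Definition initial_state (R : realType) (w : realization R) : state (npart w) :=
  State (@pos0 _ w) (@active0 _ w) (fun=> 0%N).

Section Invariants.
Variables (R : realType) (w : realization R).
Local Notation F := (envelope w).
Local Notation X0 := (initial_state w).

(** Induction along the evolution, skipping the steps where a passive particle
is selected. *)
Lemma state_at_ind (P : state (npart w) -> Prop) :
  P X0 ->
  (forall X n, active X n -> P X -> P (act_particle F n X)) ->
  forall i, P (state_at w i).
Proof.
move=> P0 PS; elim=> [//|i IH] /=; case: (label w i) => [n|//].
case: (boolP (active (state_at w i) n)) => an; first exact: PS.
by rewrite /act_particle an.
Qed.

Lemma mass_balance z i :
  (occupancy (state_at w i) z + departures F (state_at w i) z =
   occupancy X0 z + arrivals F (state_at w i) z)%N.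
Proof.
pattern (state_at w i); apply: state_at_ind => [|X n an IH].
  by rewrite /departures /arrivals /= !tally0.
have rg := @envelope_range _ w.
rewrite (departures_act F an) (arrivals_act an rg).
case: (eqVneq (F (pos X n) (burned X (pos X n))) 0) => e0 /=.
  by rewrite (occupancy_sleep an) // andbF !addn0.
by have := occupancy_jump an z e0; rewrite andbT; lia.
Qed.

(** Without arrivals nobody is woken up at [z], so jumps out of [z] are made by
distinct, initially active particles. *)
Lemma awake_without_arrivals z i :
  arrivals F (state_at w i) z = 0%N ->
  (awake (state_at w i) z + departures F (state_at w i) z <= awake X0 z)%N.
Proof.
pattern (state_at w i); apply: state_at_ind => [_|X n an IH].
  by rewrite /departures /= tally0 addn0.
have rg := @envelope_range _ w.
rewrite (departures_act F an) (arrivals_act an rg).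
case: (eqVneq (F (pos X n) (burned X (pos X n))) 0) => e0 /=.
  rewrite andbF !addn0 (awake_sleep an) //; case: ifP => _ /IH; lia.
case: (boolP (z == _)) => zt /=; first by rewrite addn1.
by rewrite addn0 => /IH; have := awake_jump an e0 zt; rewrite andbT; lia.
Qed.

(** How a site may come to hold passive particles: an arrival makes all the
particles at the site active, and afterwards an active particle can only become
passive when it is alone and burns a sleep envelope.  Without arrivals, an
initially active particle stays active unless it jumps away or falls asleep
alone. *)
Lemma passive_site_history z i (X := state_at w i) :
  [\/ awake X z = occupancy X z,
      arrivals F X z = 0%N /\
        (awake X0 z <= awake X z + departures F X z)%N
    | occupancy X z = 1%N /\ last_sleep F X z].
Proof.
rewrite /X {X}; pattern (state_at w i); apply: state_at_ind => [|X n an IH].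
  by apply: Or32; rewrite /departures /arrivals /= !tally0 !addn0.
have rg := @envelope_range _ w.
rewrite (departures_act F an) (arrivals_act an rg) (last_sleep_act F an).
have := awake_le_occupancy X z; have := awake_gt0 an.
case: (eqVneq (F (pos X n) (burned X (pos X n))) 0) => e0 /=.
  rewrite andbF !addn0 (awake_sleep an) // (occupancy_sleep an) //.
  case: (eqVneq z (pos X n)) IH => [->|_] IH; last by rewrite andbF.
  rewrite andbT; case: (boolP (alone X n)) => al.
    by move=> *; apply: Or33; rewrite alone_occupancy.
  have := not_alone_occupancy al.
  by case: IH => [?|?|[]] *; [apply: Or31|apply: Or32|lia].
case: (eqVneq z (pos X n + F (pos X n) (burned X (pos X n)))) => zt.
  by move=> *; apply: Or31; rewrite zt awake_jump_target.
rewrite andbT addn0; have := awake_jump an e0 zt; have := occupancy_jump an z e0.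
rewrite (negbTE zt); case: (eqVneq z (pos X n)) IH => [<-|zx] /= IH *.
  case: IH => [?|[? ?]|[? _]]; [apply: Or31; lia|apply: Or32; lia|apply: Or31; lia].
by case: IH => [?|[? ?]|[? ?]];
  [apply: Or31; lia|apply: Or32; lia|apply: Or33; split=> //; lia].
Qed.

(** If the particle burning the sleep envelope was alone, it fell asleep;
otherwise the site holds several particles.  Since the next departure burns a
jump envelope, the occupancy cannot decrease as long as the sleep envelope is
the last one, and an arrival at an occupied site makes it at least two. *)
Lemma after_last_sleep z i (X := state_at w i) :
  last_sleep F X z ->
  (1 < occupancy X z)%N \/ occupancy X z = 1%N /\ awake X z = 0%N.
Proof.
rewrite /X {X}; pattern (state_at w i); apply: state_at_ind => [//|X n an IH].
rewrite (last_sleep_act F an).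
case: (eqVneq z (pos X n)) => [->|zx].
  move=> /eqP e0; rewrite (awake_sleep an) // (occupancy_sleep an) // eqxx andbT.
  case: (boolP (alone X n)) => al; last by left; apply: not_alone_occupancy.
  by right; rewrite alone_occupancy.
move=> /IH {}IH.
case: (eqVneq (F (pos X n) (burned X (pos X n))) 0) => e0.
  by rewrite (awake_sleep an) // (occupancy_sleep an) // (negbTE zx) andbF.
have := occupancy_jump an z e0; rewrite (negbTE zx) addn0.
case: eqVneq => zt /= oE; first by left; lia.
by have := awake_jump an e0 zt; rewrite (negbTE zx); lia.
Qed.

Lemma jumps_burned z i :
  (\sum_(0 <= k < i) burns_jump w z k)%N = departures F (state_at w i) z.
Proof.
elim: i => [|i IH]; first by rewrite big_geq // /departures /= tally0.
rewrite big_nat_recr //= IH /burns_jump /=.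
case: (label w i) => [n|]; last by rewrite addn0.
set X := state_at w i; case: (boolP (active X n)) => an /=.
  rewrite (departures_act F an) /next_envelope [z == _]eq_sym.
  by case: eqP => [->|].
by rewrite addn0 /act_particle an.
Qed.

Lemma finitely_many_sites_burned i :
  exists s : seq int, forall z, z \notin s -> burned (state_at w i) z = 0%N.
Proof.
pattern (state_at w i); apply: state_at_ind => [|X n an [s sP]]; first by exists [::].
exists (pos X n :: s) => z; rewrite inE negb_or => /andP[/negbTE zx zs].
by rewrite (burned_act F an) zx sP.
Qed.

End Invariants.

(** * Insertion of sleep envelopes *)

(** If [phi] gives the new indices of the envelopes, [inserted_length phi k] is the
length of the shortest initial segment of the new sequence that contains the
first [k] envelopes of the old one; it ends with the last of these. *)
Definition inserted_length (phi : nat -> nat) (k : nat) : nat :=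
  if k is j.+1 then (phi j).+1 else 0%N.

Lemma tally_inserted (f f' : nat -> int) (phi : nat -> nat) (p : pred int) k :
  {homo phi : i j / (i < j)%N} -> (forall j, f' (phi j) = f j) ->
  (forall i, (forall j, phi j <> i) -> f' i = 0) -> ~~ p 0 ->
  tally f' p (inserted_length phi k) = tally f p k.
Proof.
move=> phi_mono f'phi f'0 /negbTE p0.
have phi_inj j l : phi j = phi l -> j = l.
  by case: (ltngtP j l) => // /phi_mono; lia.
elim: k => [|k IH] /=; first by rewrite !tally0.
rewrite !tallyS f'phi -IH; congr (_ + _)%N.
(* Between two consecutive copies there are only sleep envelopes. *)
have le_phi : (inserted_length phi k <= phi k)%N.
  by case: (k) => [//|l] /=; apply: phi_mono.
have gap i : (inserted_length phi k <= i < phi k)%N -> f' i = 0.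
  move=> /andP[ki ik]; apply: f'0 => j ji.
  have jk : (j < k)%N.
    by rewrite ltnNge leq_eqVlt; apply/negP => /orP[/eqP kj|/phi_mono]; [subst j|]; lia.
  case: k ki jk {IH ik le_phi} => [//|l] /= li; rewrite ltnS leq_eqVlt.
  by move=> /orP[/eqP jl|/phi_mono]; [subst j|]; lia.
move: (phi k) le_phi gap => b; move: (inserted_length phi k) => a.
elim: b => [|b IHb]; first by rewrite leqn0 => /eqP ->.
rewrite leq_eqVlt => /orP[/eqP -> //|ab] gap.
rewrite tallyS IHb // => [|i /andP[ai ib]]; last by apply: gap; rewrite ai ltnW.
by rewrite gap ?p0 ?addn0 // -ltnS ab ltnSn.
Qed.

(** * Comparison of two realizations *)

(** [w] has no active particle at step [i], and [w'] is below [w], as witnessed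
by the injection [f] of particles and the index maps [phi]. *)
Section Comparison.
Variables (R : realType) (w w' : realization R).
Variables (f : 'I_(npart w') -> 'I_(npart w)) (phi : int -> nat -> nat) (i : nat).
Hypothesis f_inj : injective f.
Hypothesis f_pos : forall n, pos0 (f n) = pos0 n.
Hypothesis f_active : forall n, active0 n -> active0 (f n).
Hypothesis phi_mono : forall z, {homo phi z : j k / (j < k)%N}.
Hypothesis phi_env : forall z j, envelope w' z (phi z j) = envelope w z j.
Hypothesis phi_sleep :
  forall z k, (forall j, phi z j <> k) -> envelope w' z k = 0.
Hypothesis w_passive : forall z, awake (state_at w i) z = 0%N.

(** The number of envelopes that [w'] may burn at [z]. *)
Let quota z := inserted_length (phi z) (burned (state_at w i) z).

Lemma tally_quota z p : ~~ p 0 ->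
  tally (envelope w' z) p (quota z) =
  tally (envelope w z) p (burned (state_at w i) z).
Proof. by move=> p0; apply: tally_inserted => //; apply: phi_sleep. Qed.

Lemma leq_sum_injection (a : pred 'I_(npart w')) (b : pred 'I_(npart w)) :
  (forall n, a n -> b (f n)) -> (\sum_n a n <= \sum_n b n)%N.
Proof.
move=> ab; apply: (@leq_trans (\sum_n b (f n))).
  by apply: leq_sum => n _; case: (a n) (ab n) => // ->.
rewrite -(big_imset (fun k => nat_of_bool (b k)) (in2W f_inj)) /=.
by rewrite [leqRHS](bigID (mem (f @: 'I_(npart w')))) leq_addr.
Qed.

Lemma initial_occupancy_le z :
  (occupancy (initial_state w') z <= occupancy (initial_state w) z)%N.
Proof. by apply: leq_sum_injection => n /=; rewrite f_pos. Qed.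

Lemma initial_awake_le z :
  (awake (initial_state w') z <= awake (initial_state w) z)%N.
Proof.
by apply: leq_sum_injection => n /= /andP[/f_active -> /=]; rewrite f_pos.
Qed.

Lemma awake_below_quota k z (X' := state_at w' k) :
  (forall y, burned X' y <= quota y)%N -> (0 < awake X' z)%N ->
  (burned X' z < quota z)%N.
Proof.
rewrite /X' => {X'} below aw; rewrite ltnNge; apply/negP => full.
have full_eq : burned (state_at w' k) z = quota z.
  by apply/eqP; rewrite eqn_leq below full.
pose X := state_at w i; pose X' := state_at w' k.
have dep : departures (envelope w') X' z = departures (envelope w) X z.
  by rewrite /departures full_eq tally_quota //= eqxx.
have arr : (arrivals (envelope w') X' z <= arrivals (envelope w) X z)%N.
  by apply: leq_add; rewrite -tally_quota //; apply: leq_tally.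
have occ : (occupancy X' z <= occupancy X z)%N.
  have := initial_occupancy_le z.
  by have := mass_balance w z i; have := mass_balance w' z k; rewrite -/X -/X'; lia.
rewrite -/X' in aw; have := awake_le_occupancy X' z.
have : awake X z = 0%N := w_passive z.
case: (passive_site_history w z i) => [|[arr0 deps]|[occ1]].
- by rewrite -/X; lia.
- have := awake_without_arrivals (w := w') (z := z) (i := k).
  by have := initial_awake_le z; rewrite -/X -/X' in arr0 deps *; lia.
- move=> /andP[J_gt0 slept].
  have : last_sleep (envelope w') X' z.
    rewrite /last_sleep full_eq /quota.
    by case: (burned _ _) J_gt0 slept => [//|j] _ /=; rewrite phi_env.
  by move=> /after_last_sleep; rewrite -/X -/X' in occ1 *; lia.
Qed.

Lemma burned_le_quota k z : (burned (state_at w' k) z <= quota z)%N.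
Proof.
elim: k z => [//|k IH] z /=; case: (label w' k) => [n|//].
case: (boolP (active (state_at w' k) n)) => an; last by rewrite /act_particle an.
rewrite burned_act //; case: eqVneq => [->|_]; last by rewrite addn0.
by rewrite addn1; apply: awake_below_quota => //; exact: awake_gt0.
Qed.

Lemma departures_le k z :
  (departures (envelope w') (state_at w' k) z <=
   departures (envelope w) (state_at w i) z)%N.
Proof.
rewrite [leqRHS]/departures -tally_quota /= ?eqxx //.
exact/leq_tally/burned_le_quota.
Qed.

(** The total number of envelopes burned at the finitely many sites with nonzero
quota is bounded, and it grows at every step of an active particle; from the
step where it is maximal on, only passive particles are selected. *)
Lemma eventually_frozen :
  exists k, forall l, (k <= l)%N ->
    state_at w' l = state_at w' k /\ forall n, ~~ active (state_at w' l) n.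
Proof.
have [s s_burned] := finitely_many_sites_burned w i.
pose potential k := (\sum_(z <- s) burned (state_at w' k) z)%N.
have potential_active k n : label w' k = Some n -> active (state_at w' k) n ->
    (potential k < potential k.+1)%N.
  move=> kn an; set X := state_at w' k; rewrite /potential /= kn -/X.
  (* Having just burned an envelope, the site has a nonzero quota. *)
  have xs : pos X n \in s.
    apply: contraT => /s_burned x0; have := burned_le_quota k.+1 (pos X n).
    by rewrite /quota x0 /= kn burned_act // eqxx addn1.
  rewrite (eq_bigr _ (fun y _ => burned_act (envelope w') an y)) big_split /=.
  rewrite -addn1 leq_add2l -/X; elim: s xs {s_burned potential} => // y s IH.
  rewrite inE big_cons [y == _]eq_sym => /orP[->//|/IH]; lia.
have potential_step k : (potential k <= potential k.+1)%N.
  case kn: (label w' k) => [n|]; last by rewrite /potential /= kn.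
  case: (boolP (active (state_at w' k) n)) => an.
    exact: ltnW (potential_active _ _ kn an).
  by rewrite /potential /= kn /act_particle an.
have potential_mono k l : (k <= l)%N -> (potential k <= potential l)%N.
  exact: (homo_leq (@leqnn) leq_trans).
have [k k_max] : exists k, forall l, (potential l <= potential k)%N.
  pose attained m := `[< exists k, potential k = m >].
  have exP : exists m, attained m.
    by exists (potential 0%N); apply/asboolP; exists 0%N.
  have ubP m : attained m -> (m <= \sum_(z <- s) quota z)%N.
    by move=> /asboolP[k <-]; apply: leq_sum => z _; exact: burned_le_quota.
  case: (ex_maxnP exP ubP) => m /asboolP[k <-] mP.
  by exists k => l; apply: mP; apply/asboolP; exists l.
have idle l n : (k <= l)%N -> label w' l = Some n -> ~~ active (state_at w' l) n.
  move=> /potential_mono kl ln; apply/negP => /(potential_active _ _ ln).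
  by have := k_max l.+1; lia.
have const l : (k <= l)%N -> state_at w' l = state_at w' k.
  move=> /subnKC <-; elim: (l - k)%N => [|d IH]; first by rewrite addn0.
  rewrite addnS /=; case dn: (label w' _) => [n|//].
  by rewrite /act_particle (idle _ _ _ dn) ?leq_addr.
exists k => l kl; split=> [|n]; first exact: const.
have [j kj jn] := label_infinitely_often n k.
by rewrite const // -(const j) // idle.
Qed.

End Comparison.

(** * Continuous time and the number of jumps *)

Section Time.
Variables (R : realType) (w : realization R).

Lemma time_cell (t : R) : 0 <= t -> exists k, time w k <= t < time w k.+1.
Proof.
move=> t_ge0; have ex_later : exists k, t < time w k.
  have /cvgryPgt/(_ t)[k _ k_later] := time_unbounded w.
  by exists k; apply: k_later => /=.
case: (ex_minnP ex_later) => -[|k] tk k_min.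
  by rewrite time0 ltNge t_ge0 in tk.
by exists k; rewrite tk andbT leNgt; apply/negP => /k_min; rewrite ltnn.
Qed.

Lemma process_state_at (t : R) : 0 <= t -> exists2 k,
  process w t = configuration (state_at w k) & time w k <= t < time w k.+1.
Proof.
move=> /time_cell[k kt]; rewrite /process.
set A := (X in xget _ X); exists (xget 0%N A) => //.
exact: (xgetPex 0%N (ex_intro A k kt)).
Qed.

Lemma stabilizes_passive : stabilizes w ->
  exists i, forall z, awake (state_at w i) z = 0%N.
Proof.
move=> [t0 [t0_ge0 [eta [cst passive]]]].
have [k kE _] := process_state_at t0_ge0; exists k => z.
have := passive z; rewrite -(cst _ (lexx t0)) kE /configuration /= => <-.
rewrite /awake -sum1_card [in RHS]big_mkcond /=; apply: eq_bigr => n _.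
by rewrite inE andbC; case: ifP.
Qed.

Lemma frozen_stabilizes k :
  (forall l, (k <= l)%N ->
     state_at w l = state_at w k /\ forall n, ~~ active (state_at w l) n) ->
  stabilizes w.
Proof.
move=> frozen.
have time_mono l j : (l <= j)%N -> time w l <= time w j.
  by rewrite leq_eqVlt => /orP[/eqP ->//|/time_increasing/ltW].
have tk_ge0 : 0 <= time w k by rewrite -(time0 w) time_mono.
exists (time w k); split => //; exists (configuration (state_at w k)); split.
  move=> t kt; have [l -> /andP[_ tl]] := process_state_at (le_trans tk_ge0 kt).
  case: (leqP k l) => [/frozen[->//]|lk].
  by have := lt_le_trans tl (time_mono _ _ lk); rewrite ltNge kt.
move=> z; rewrite /configuration /=; apply: eq_card0 => n; rewrite inE.
by have [_ /(_ n)/negbTE ->] := frozen k (leqnn k); rewrite andbF.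
Qed.

Lemma jumps_at_ge z k :
  ((departures (envelope w) (state_at w k) z)%:R%:E <= jumps_at w z)%E.
Proof.
rewrite -jumps_burned natr_sum -sumEFin.
by apply: nneseries_lim_ge => j _; rewrite lee_fin.
Qed.

Lemma jumps_at_le z b :
  (forall k, (departures (envelope w) (state_at w k) z <= b)%N) ->
  (jumps_at w z <= b%:R%:E)%E.
Proof.
move=> le_b; apply: lime_le.
  by apply: is_cvg_nneseries => j _ _; rewrite lee_fin.
near=> k; rewrite sumEFin -natr_sum lee_fin ler_nat jumps_burned; exact: le_b.
Unshelve. all: by end_near. Qed.

End Time.

Theorem theorem1p3 (R : realType) (w w' : realization R) :
  stabilizes w -> preceq w' w ->
  stabilizes w' /\ forall z : int, (jumps_at w' z <= jumps_at w z)%E.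
Proof.
move=> /stabilizes_passive[i w_passive] [[f [f_inj f_pos f_active]] insertion].
have [phi phiP] := choice insertion.
have phi_mono z : {homo phi z : j k / (j < k)%N} by have [] := phiP z.
have phi_env z j : envelope w' z (phi z j) = envelope w z j by have [] := phiP z.
have phi_sleep z k : (forall j, phi z j <> k) -> envelope w' z k = 0.
  by have [_ _] := phiP z; apply.
split=> [|z].
  have [k] := eventually_frozen f_inj f_pos f_active phi_mono phi_env phi_sleep
                                w_passive.
  exact: frozen_stabilizes.
apply: le_trans (jumps_at_ge w z i); apply: jumps_at_le => k.
exact: (departures_le f_inj f_pos f_active phi_mono phi_env phi_sleep
                      w_passive).
Qed.
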